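(* Let $r\ge1$, let $\eta\in\mathcal{C}_r$ be a local configuration, and let the potentials satisfy $a(n)<0$, $b(n)\ge0$ and $a(n)+2\mathcal{V}b(n)\le0$. Let $\zeta_-$ and $\zeta_+$ be the configurations of $\tilde{\mathcal{X}}_n$ whose vertices are all negative and all positive, respectively. Then: (1) if $\lim_{n\to+\infty}n^dW_n(\eta)=0$, then $\lim_{n\to+\infty}\tilde\mu_{a,b}(\zeta_-)=1$; (2) if $\lim_{n\to+\infty}n^dW_n(\eta)=+\infty$, then $\lim_{n\to+\infty}\tilde\mu_{a,b}(\zeta_-)=0$; (3) if $\displaystyle\lim_{n\to+\infty}R(n)^d\,\Bigl(\ln\frac{n}{R(n)}\Bigr)^{-1}W_n(\eta)=+\infty$, then $\lim_{n\to+\infty}\tilde\mu_{a,b}(\zeta_+)=1$.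
   Context: Fix a dimension $d\ge1$. Let $V_n=\{0,\dots,n-1\}^d$ be the lattice torus (all operations on vertices are modulo $n$). Two vertices are neighbors, i.e. $\{x,y\}\in E_n$, iff $\|y-x\|_\infty=1$ (subtraction modulo $n$); each vertex has the same number $\mathcal{V}$ of neighbors. $\mathrm{dist}$ is the graph distance (equal to the $L_\infty$ distance on the torus) and $B(x,R)=\{y\in V_n:\mathrm{dist}(x,y)\le R\}$; it is assumed that $n>2r$. Configurations are elements $\sigma\in\mathcal{X}_n=\{-1,+1\}^{V_n}$. The Gibbs measure with potentials $a,b$ is $$\mu_{a,b}(\sigma)=\frac1{Z_{a,b}}\exp\Bigl(a\sum_{x\in V_n}\sigma(x)+b\sum_{\{x,y\}\in E_n}\sigma(x)\sigma(y)\Bigr),$$ with $Z_{a,b}$ the normalizing constant; the potentials $a=a(n)$, $b=b(n)$ depend on $n$ and $\mu_{a(n),b(n)}$ is still written $\mu_{a,b}$. Local configurations with radius $r$ ($r$ fixed, independent of $n$) are the elements $\eta$ of $\mathcal{C}_r=\{-1,+1\}^{B(0,r)}$. Let $V_+(\eta)=\{x\in B(0,r):\eta(x)=+1\}$, $k(\eta)=|V_+(\eta)|$, perimeter $\gamma(\eta)=\mathcal{V}\,k(\eta)-2\,|\{\{x,y\}\in E_n: x,y\in V_+(\eta)\}|$, and weight $W_n(\eta)=\exp(2a(n)k(\eta)-2b(n)\gamma(\eta))$. For $x\in V_n$, $I_x^\eta(\sigma)=1$ if the restriction of $\sigma$ to $B(x,r)$ is the translate of $\eta$ (i.e. $\sigma(x+y)=\eta(y)$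 for all $y\in B(0,r)$) and $I_x^\eta(\sigma)=0$ otherwise. Sizes and blocks: the size $n$ is restricted to a nondecreasing sequence of positive integers tending to infinity (limits $n\to+\infty$ are along this sequence), along which there are positive integers $R(n)$ such that $R(n)$ is nondecreasing and $n/(2R(n)+1)$ is a nondecreasing sequence of integers. Let $$\tilde V_n=\Bigl\{i(2R(n)+1): i=0,\dots,\tfrac{n}{2R(n)+1}-1\Bigr\}^d\subset V_n ,$$ so that the balls $B(x,R(n))$, $x\in\tilde V_n$, partition $V_n$; put $\tilde{\mathcal{X}}_n=\{-1,+1\}^{\tilde V_n}$. Given $\eta$, define $f:\mathcal{X}_n\to\tilde{\mathcal{X}}_n$ by: $f(\sigma)(x)=+1$ if and only if there exists $y\in B(x,R(n))$ with $I_y^\eta(\sigma)=1$. The probability measure $\tilde\mu_{a,b}$ on $\tilde{\mathcal{X}}_n$ is the image measure $\tilde\mu_{a,b}(\zeta)=\mu_{a,b}(f^{-1}(\zeta))$. *)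

(* Defs.v *)
From HB Require Import structures.
From mathcomp Require Import all_boot all_order all_algebra.
From mathcomp Require Import zify.
From mathcomp Require Import all_classical all_reals all_analysis.

Set Implicit Arguments.
Unset Strict Implicit.
Unset Printing Implicit Defensive.

Import Order.TTheory GRing.Theory Num.Theory.
Import numFieldNormedType.Exports.

Local Open Scope ring_scope.

(* The lattice torus {0, ..., n-1}^d, with vertex operations modulo n.  As    *)
(* ['Z_n] is Z/nZ only for 1 < n, this is the torus only for 1 < n.           *)
Notation torus d n := 'rV['Z_n]_d.

Section Torus.
Variables d n : nat.
Implicit Types x y v : torus d n.

(* The distance from z to 0 on the cycle Z/nZ. *)
Definition cycle_abs (z : 'Z_n) : nat := minn z (n - z).

Definition supnorm v : nat := (\max_(i < d) cycle_abs (v ord0 i))%N.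

Definition neighbor : rel (torus d n) := [rel x y | supnorm (y - x) == 1%N].

Definition edges : {set {set torus d n}} :=
  [set [set p.1; p.2] | p : torus d n * torus d n & neighbor p.1 p.2].

(* All vertices have the same number of neighbors, see [card_neighbor]. *)
Definition valence : nat := #|[set y : torus d n | neighbor 0 y]|.

(* Least length of a path from x to y in the graph; shortest paths have fewer *)
(* than #|torus d n| steps.  [distE] identifies it with the sup distance.     *)
Definition dist x y : nat :=
  find (fun k => [exists p : k.-tuple (torus d n),
                    path neighbor x p && (last x p == y)])
       (iota 0 #|{: torus d n}|).

Definition ball x (k : nat) : {set torus d n} := [set y | (dist x y <= k)%N].

End Torus.

Section TorusTheory.
Variables d n : nat.
Hypothesis n_gt1 : (1 < n)%N.
Implicit Types x y v w : torus d n.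

Local Lemma trunc_n : (Zp_trunc n).+2 = n.
Proof. exact: Zp_cast. Qed.

Lemma Zn_lt (z : 'Z_n) : (z < n)%N.
Proof. by rewrite -[n in (_ < n)%N]trunc_n ltn_ord. Qed.

Lemma Zn_addE (z w : 'Z_n) : (z + w)%R = (if (z + w < n)%N then z + w else z + w - n)%N :> nat.
Proof.
have -> : val (z + w) = ((z + w) %% n)%N by rewrite /=; congr (_ %% _)%N; exact: trunc_n.
have := Zn_lt z; have := Zn_lt w; case: (ltnP (z + w)%N n) => h hw hz.
  by rewrite modn_small.
by rewrite -[X in (X %% _)%N](subnK h) modnDr modn_small //; lia.
Qed.

Lemma Zn_oppE (z : 'Z_n) : (- z)%R = (if val z == 0%N then 0 else n - z)%N :> nat.
Proof.
have -> : val (- z) = ((n - z) %% n)%N.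
  by rewrite /=; congr ((_ - _) %% _)%N; exact: trunc_n.
have := Zn_lt z; case: eqP => h hz.
  by rewrite h subn0 modnn.
by move: h => /= h; rewrite modn_small; lia.
Qed.

Lemma cycle_absN (z : 'Z_n) : cycle_abs (- z) = cycle_abs z.
Proof. by rewrite /cycle_abs Zn_oppE; have := Zn_lt z; case: eqP => /= *; lia. Qed.

Lemma cycle_absD (z w : 'Z_n) : (cycle_abs (z + w)%R <= cycle_abs z + cycle_abs w)%N.
Proof.
rewrite /cycle_abs Zn_addE; have := Zn_lt z; have := Zn_lt w.
by case: (ltnP (z + w)%N n) => /= *; lia.
Qed.

Lemma supnormN v : supnorm (- v) = supnorm v.
Proof. by apply: eq_bigr => i _; rewrite mxE cycle_absN. Qed.

Lemma supnorm_leP v k :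
  reflect (forall i, (cycle_abs (v ord0 i) <= k)%N) (supnorm v <= k)%N.
Proof.
apply: (iffP idP) => [h i|h]; last by apply/bigmax_leqP => i _; exact: h.
exact: leq_trans (leq_bigmax (F := fun i => cycle_abs (v ord0 i)) i) h.
Qed.

Lemma supnormD v w : (supnorm (v + w)%R <= supnorm v + supnorm w)%N.
Proof.
apply/supnorm_leP => i; rewrite mxE; apply: leq_trans (cycle_absD _ _) _.
apply: leq_add.
  exact: (leq_bigmax (F := fun i => cycle_abs (v ord0 i))).
exact: (leq_bigmax (F := fun i => cycle_abs (w ord0 i))).
Qed.

Lemma supnorm0 : supnorm (0 : torus d n) = 0%N.
Proof. by rewrite /supnorm big1 // => i _; rewrite mxE /cycle_abs /= min0n. Qed.

Lemma supnorm_eq0 v : (supnorm v == 0%N) = (v == 0).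
Proof.
apply/idP/eqP => [|->]; last by rewrite supnorm0.
rewrite -leqn0 => /supnorm_leP h; apply/rowP => i; rewrite mxE.
have := h i; rewrite leqn0 /cycle_abs => /eqP hi; apply: val_inj => /=.
have h1 := Zn_lt (v ord0 i). have h2 : nat_of_ord (v ord0 i) = 0%N by lia. by rewrite h2.
Qed.

Lemma supnorm_path x p : path (@neighbor d n) x p -> (supnorm (last x p - x)%R <= size p)%N.
Proof.
elim: p x => [|y p IH] x /=; first by rewrite subrr supnorm0.
case/andP=> /eqP xy /IH h; rewrite -(subrKA y) addrC.
by apply: leq_trans (supnormD _ _) _; rewrite xy add1n ltnS.
Qed.

Local Definition toward0 v : torus d n :=
  \row_i (if v ord0 i == 0%N :> nat then 0
          else if (v ord0 i <= n - v ord0 i)%N then 1 else - 1).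

Lemma Zn_1E : (1 : 'Z_n) = 1%N :> nat.
Proof. by rewrite /= modn_small // trunc_n. Qed.

Lemma cycle_abs1 : cycle_abs (1 : 'Z_n) = 1%N.
Proof. by rewrite /cycle_abs Zn_1E; lia. Qed.

Lemma Zn_addr1 (z : 'Z_n) :
  (z + 1)%R = (if z.+1 == n then 0 else z.+1)%N :> nat.
Proof.
rewrite Zn_addE Zn_1E addn1; have := Zn_lt z.
by case: eqP; case: (ltnP z.+1 n); lia.
Qed.

Lemma Zn_subr1 (z : 'Z_n) : z != 0%N :> nat -> (z - 1)%R = z.-1 :> nat.
Proof.
move=> z0; rewrite Zn_addE Zn_oppE.
have -> : \val (1 : 'Z_n) = 1%N by exact: Zn_1E.
rewrite Zn_1E /=; have := Zn_lt z.
by case: (ltnP (z + (n - 1)) n); lia.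
Qed.

Lemma supnorm_toward0 v k : supnorm v = k.+1 ->
  supnorm (toward0 v) = 1%N /\ supnorm (v - toward0 v) = k.
Proof.
move=> vk.
have c i : cycle_abs ((v - toward0 v) ord0 i) = (cycle_abs (v ord0 i)).-1.
  rewrite !mxE; case: ifPn => [/eqP h|h].
    by rewrite subr0 /cycle_abs h !min0n.
  case: ifPn => h2; rewrite /cycle_abs.
    rewrite Zn_subr1 //; have := Zn_lt (v ord0 i).
    by move: (nat_of_ord _) h h2 => m; lia.
  rewrite opprK Zn_addr1; have := Zn_lt (v ord0 i).
  by move: (nat_of_ord _) h h2 => m; case: (m.+1 =P n); lia.
have w1 i : cycle_abs (toward0 v ord0 i) = (0 < cycle_abs (v ord0 i))%N.
  rewrite mxE; have := Zn_lt (v ord0 i); case: ifPn => [/eqP h _|h].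
    by rewrite /cycle_abs h min0n.
  by case: ifPn => h2 hn; rewrite ?cycle_absN cycle_abs1 /cycle_abs; move: h h2; lia.
have hd : (0 < #|'I_d|)%N.
  rewrite card_ord; case: (posnP d) => // d0; move: vk; rewrite /supnorm big1 // => i.
  by have := ltn_ord i; rewrite {2}d0.
have [i0 hi0] : {i0 | supnorm v = cycle_abs (v ord0 i0)} .
  exact: (bigop.eq_bigmax (fun i => cycle_abs (v ord0 i)) hd).
split; apply/eqP; rewrite eqn_leq; apply/andP; split.
- by apply/supnorm_leP => i; rewrite w1; case: (_ < _)%N.
- apply: leq_trans (leq_bigmax i0).
  by rewrite w1 -hi0 vk.
- apply/supnorm_leP => i; rewrite c -ltnS -vk.
  have := leq_bigmax (F := fun i => cycle_abs (v ord0 i)) i.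
  by rewrite -/(supnorm v) vk; lia.
- by apply: leq_trans (leq_bigmax i0); rewrite c -hi0 vk.
Qed.

Lemma path_supnorm x y k : supnorm (y - x) = k ->
  exists p : k.-tuple (torus d n), path (@neighbor d n) x p && (last x p == y).
Proof.
elim: k x => [|k IH] x h.
  exists [tuple] => /=; have /eqP := h; rewrite supnorm_eq0 subr_eq0 eq_sym //.
have [w1 wk] := supnorm_toward0 h.
set w := toward0 _ in w1 wk.
have [|p /andP[pp lp]] := IH (x + w); first by rewrite opprD addrA.
by exists [tuple of x + w :: p]; rewrite /= pp lp /neighbor /= addrC addKr w1 eqxx.
Qed.

Lemma supnorm_ltn_card v : (supnorm v < #|{: torus d n}|)%N.
Proof.
rewrite card_mx mul1n card_ord trunc_n.
case: (posnP d) => [d0|d_gt0].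
  rewrite [X in (_ ^ X)%N]d0 expn0 /supnorm big1 // => i.
  by have := ltn_ord i; rewrite {2}d0.
apply: (@leq_ltn_trans n.-1).
  apply/supnorm_leP => i; rewrite /cycle_abs; have := Zn_lt (v ord0 i); lia.
rewrite prednK; last lia.
by rewrite -{1}(expn1 n) leq_exp2l.
Qed.

Lemma distE x y : dist x y = supnorm (y - x).
Proof.
rewrite /dist; set P := fun k => _; set k := supnorm _.
have Pk : P k by apply/existsP; apply: path_supnorm.
have lek j : P j -> (k <= j)%N.
  by case/existsP => p /andP[/supnorm_path + /eqP pl]; rewrite pl size_tuple.
have hk : (k < #|{: torus d n}|)%N := supnorm_ltn_card _.
have hP : has P (iota 0 #|{: torus d n}|).
  by apply/hasP; exists k; rewrite // mem_iota.
apply/eqP; rewrite eqn_leq; apply/andP; split.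
  rewrite leqNgt; apply/negP => /(before_find 0%N).
  by rewrite nth_iota // add0n Pk.
have hf : (find P (iota 0 #|{: torus d n}|) < #|{: torus d n}|)%N.
  by rewrite -[X in (_ < X)%N](size_iota 0) -has_find.
by have := nth_find 0%N hP; rewrite nth_iota // add0n => /lek.
Qed.

Lemma card_neighbor x : #|[set y | neighbor x y]| = valence d n.
Proof.
rewrite /valence -[RHS](card_imset _ (addrI x)); apply: eq_card => y; rewrite !inE.
apply/idP/imsetP => [xy|[z + ->]].
  by exists (y - x); rewrite ?inE /neighbor /= ?subr0 // addrC subrK.
by rewrite inE /neighbor /= subr0 addrAC subrr add0r.
Qed.

Lemma Zn_natE m : (m < n)%N -> (m%:R : 'Z_n) = m :> nat.
Proof. by move=> h; rewrite val_Zp_nat // modn_small. Qed.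

Lemma Zn_subrE (z w : 'Z_n) :
  (z - w)%R = (if w <= z then z - w else z + n - w)%N :> nat.
Proof.
rewrite Zn_addE Zn_oppE; have := Zn_lt z; have := Zn_lt w.
have -> : \val w = nat_of_ord w by [].
move: (nat_of_ord z) (nat_of_ord w) => p q.
case: (q =P 0%N) => q0; case: ifP; case: ifP; lia.
Qed.

End TorusTheory.

(* Spins are booleans: true is +1 and false is -1. *)
Definition spin (R : realType) (s : bool) : R := if s then 1 else -1.

Definition config d n := {ffun torus d n -> bool}.

Section Gibbs.
Variables (R : realType) (d n : nat) (a b : R).

Definition gibbs_factor (s : config d n) : R :=
  expR (a * (\sum_(x : torus d n) spin R (s x))
        + b * (\sum_(e in edges d n) \prod_(x in e) spin R (s x))).

Definition partition_function : R := \sum_(s : config d n) gibbs_factor s.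

Definition gibbs (s : config d n) : R := gibbs_factor s / partition_function.

Definition gibbs_measure (A : {set config d n}) : R := \sum_(s in A) gibbs s.

End Gibbs.

(* A local configuration of radius r must not depend on n, so the ball B(0,r) *)
(* is indexed by {0, ..., 2r}^d, the index u standing for u - (r, ..., r)     *)
(* modulo n.  For n > 2r this is a bijection onto B(0,r), see [offset_inj]    *)
(* and [offset_ball].                                                         *)
Definition box d r := {ffun 'I_d -> 'I_(r.*2.+1)}.

Definition local_config d r := {ffun box d r -> bool}.

Definition offset d n r (u : box d r) : torus d n :=
  \row_i ((u i)%:R - r%:R).

Section OffsetTheory.
Variables d n r : nat.
Hypotheses (n_gt1 : (1 < n)%N) (n_gt2r : (2 * r < n)%N).

Lemma offset_inj : injective (@offset d n r).
Proof.
move=> u v /rowP h; apply/ffunP => i; apply: val_inj.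
have := h i; rewrite !mxE => /addIr /(congr1 val) /=.
have := ltn_ord (u i); have := ltn_ord (v i) => hv hu.
by rewrite !(Zn_natE n_gt1) //; lia.
Qed.

Lemma offset_ball : [set offset n u | u : box d r] = ball (0 : torus d n) r.
Proof.
have rn : (r < n)%N by lia.
apply/setP => y; rewrite inE (distE n_gt1) subr0; apply/imsetP/supnorm_leP.
  case=> u _ -> i; have := ltn_ord (u i) => hu.
  have hn : (u i < n)%N by lia.
  rewrite mxE /cycle_abs (Zn_subrE n_gt1) !(Zn_natE n_gt1) //.
  by move: (nat_of_ord _) hu hn => m; case: (leqP r m); lia.
move=> h; exists [ffun i => inord (y ord0 i + r%:R : 'Z_n)%R] => //.
apply/rowP => i; rewrite !mxE ffunE inordK ?natr_Zp ?addrK //.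
move: (h i); rewrite /cycle_abs (Zn_addE n_gt1) (Zn_natE n_gt1) //.
have := Zn_lt n_gt1 (y ord0 i).
by move: (nat_of_ord _) => m; case: (ltnP (m + r) n); lia.
Qed.

End OffsetTheory.

Section LocalConfig.
Variables (d n r : nat) (eta : local_config d r).

Definition Vplus : {set torus d n} := [set offset n u | u : box d r & eta u].

Definition kplus : nat := #|Vplus|.

Definition perimeter : int :=
  (valence d n * kplus)%N%:Z
  - (2 * #|[set e in edges d n | e \subset Vplus]|)%N%:Z.

Definition weight (R : realType) (a b : R) : R :=
  expR (2 * a * kplus%:R - 2 * b * perimeter%:~R).

(* The indicator I_x^eta, as a boolean. *)
Definition occurs (x : torus d n) (s : config d n) : bool :=
  [forall u : box d r, s (x + offset n u) == eta u].

End LocalConfig.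

Section Blocks.
Variables d n k : nat.

Definition centers : {set torus d n} :=
  [set x : torus d n | [forall i : 'I_d, exists j : 'I_(n %/ (2 * k + 1))%N,
                        x ord0 i == (j * (2 * k + 1))%N%:R]].

Definition block_config := {ffun {x : torus d n | x \in centers} -> bool}.

Definition renorm r (eta : local_config d r) (s : config d n) : block_config :=
  [ffun x => [exists y in ball (val x) k, occurs eta y s]].

Definition all_minus : block_config := [ffun => false].
Definition all_plus : block_config := [ffun => true].

Definition block_measure (R : realType) (a b : R) r (eta : local_config d r)
    (z : block_config) : R :=
  gibbs_measure a b [set s | renorm eta s == z].

End Blocks.

(* Main.v *)
(* Identify a configuration with the set P of its positive vertices: the Gibbs weight is then
   proportional to w(P) = exp(2a|P| - 2b(V|P| - 2e(P))), with e(P) the number of edges inside P,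
   and W(eta) = w(V_+(eta)).  Since e is superadditive on disjoint unions, adding to P a set A
   disjoint from P multiplies w(P) by at least w(A); since e(P u Q) <= e(P) + V|Q| and
   a + Vb <= 0, adding positive vertices never increases w.
   Upper bound: if P contains a copy A of V_+(eta), deleting A and all its neighbors from P turns
   its weight into at least w(P)/w(A), and boundedly many P have the same image; so I_x^eta has
   expectation at most C W(eta), and (1) is a union bound.
   Lower bound: resetting P on B(x,r) to the copy of eta shows that, given anything outside B(x,r),
   eta occurs at x with probability at least c W(eta).  Hence M disjoint balls all avoid eta with
   probability at most exp(-c W(eta) M).  The torus contains order n^d disjoint balls, which
   gives (2), and a block order R^d, which gives (3) by a union bound over the blocks. *)

Require Import Defs.
From HB Require Import structures.
From mathcomp Require Import all_boot all_order all_algebra.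
From mathcomp Require Import zify ring lra.
From mathcomp Require Import all_classical all_reals all_analysis.
(* Imported again: classical sets shadow [finset], and topology shadows [ball]. *)
From mathcomp Require Import fintype finset.
Require Import Defs.

Set Implicit Arguments.
Unset Strict Implicit.
Unset Printing Implicit Defensive.

Import Order.TTheory GRing.Theory Num.Theory.
Import numFieldNormedType.Exports.
Local Open Scope ring_scope.

(** * Counting through fibres and unions of finite sets *)

Lemma sum_fibre_le (R : numDomainType) (T U : finType) (D : {pred T})
    (D' : {pred U}) (f : T -> U) (g : U -> R) (K : nat) :
  (forall u, 0 <= g u) -> {in D, forall t, f t \in D'} ->
  (forall u, (#|[set t in D | f t == u]| <= K)%N) ->
  \sum_(t in D) g (f t) <= K%:R * \sum_(u in D') g u.
Proof.
move=> g0 fD fK; rewrite (partition_big f (mem D')) //= mulr_sumr.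
apply: ler_sum => u _; rewrite (eq_bigr (fun=> g u)); last first.
  by move=> t /andP[_ /eqP ->].
rewrite sumr_const -[X in X <= _]mulr_natl ler_wpM2r // ler_nat.
by apply: leq_trans (fK u); rewrite -cardsE; apply/subset_leq_card/subsetP => t; rewrite !inE.
Qed.

Lemma leq_cardsU (T : finType) (A B : {set T}) : (#|A :|: B| <= #|A| + #|B|)%N.
Proof. by rewrite cardsU leq_subr. Qed.

Lemma leq_card_bigcup (I T : finType) (P : pred I) (F : I -> {set T}) :
  (#|\bigcup_(i | P i) F i| <= \sum_(i | P i) #|F i|)%N.
Proof.
elim/big_rec2: _ => [|i m A _ IH]; first by rewrite cards0.
by apply: leq_trans (leq_cardsU _ _) _; rewrite leq_add2l.
Qed.

(** * Edges inside vertex sets of a regular graph *)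

Section RegularGraph.
Variables (V : finType) (E : {set {set V}}) (deg : nat).
Hypothesis card_edge : {in E, forall e : {set V}, #|e| = 2%N}.
Hypothesis degree : forall x, #|[set e in E | x \in e]| = deg.
Implicit Types A O P Q S T : {set V}.

Definition inner_edges P : {set {set V}} := [set e in E | e \subset P].

(** An edge inside [P :|: Q] but not inside [P] contains a vertex of [Q], and each vertex lies on
    [deg] edges. *)
Lemma card_inner_edgesU_le P Q :
  (#|inner_edges (P :|: Q)| <= #|inner_edges P| + deg * #|Q|)%N.
Proof.
have sub : inner_edges (P :|: Q) \subset
    inner_edges P :|: \bigcup_(q in Q) [set e in E | q \in e].
  apply/subsetP => e; rewrite !inE => /andP[eE ePQ]; rewrite eE /=.
  have [//|/subsetPn[q qe qP]] := boolP (e \subset P).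
  have := subsetP ePQ q qe; rewrite inE (negPf qP) /= => qQ.
  by apply/bigcupP; exists q; rewrite // inE eE.
apply: leq_trans (subset_leq_card sub) _.
apply: leq_trans (leq_cardsU _ _) _; rewrite leq_add2l.
apply: leq_trans (leq_card_bigcup _ _) _.
by under eq_bigr do rewrite degree; rewrite sum_nat_const mulnC.
Qed.

Lemma card_inner_edgesU_ge P Q : [disjoint P & Q] ->
  (#|inner_edges P| + #|inner_edges Q| <= #|inner_edges (P :|: Q)|)%N.
Proof.
move=> PQ; have I0 : inner_edges P :&: inner_edges Q = set0.
  apply/eqP; rewrite -subset0; apply/subsetP => e; rewrite !inE.
  case/andP => /andP[eE eP] /andP[_ eQ].
  have : e \subset P :&: Q by rewrite subsetI eP.
  by rewrite (disjoint_setI0 PQ) subset0 => /eqP e0; move: (card_edge eE); rewrite e0 cards0.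
rewrite -[leqLHS]subn0 -(cards0 {set V}) -I0 -cardsU; apply/subset_leq_card/subsetP => e.
by rewrite !inE => /orP[] /andP[-> /=] h; rewrite (subset_trans h) ?subsetUl ?subsetUr.
Qed.

(** [A] with its neighbors; [A] is added explicitly because a vertex of degree 0 lies on no edge. *)
Definition edge_closure A : {set V} := A :|: cover [set e in E | ~~ [disjoint e & A]].

Lemma card_edge_closure_le A : (#|edge_closure A| <= #|A| + 2 * (deg * #|A|))%N.
Proof.
apply: leq_trans (leq_cardsU _ _) _; rewrite leq_add2l.
apply: leq_trans (leq_card_cover _) _.
rewrite (eq_bigr (fun=> 2%N)); last by move=> e; rewrite inE => /andP[/card_edge].
rewrite sum_nat_const mulnC leq_mul2l /=.
have sub : [set e in E | ~~ [disjoint e & A]] \subset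
    \bigcup_(x in A) [set e in E | x \in e].
  apply/subsetP => e; rewrite inE => /andP[eE /pred0Pn[x /andP[xe xA]]].
  by apply/bigcupP; exists x; rewrite // inE eE.
apply: leq_trans (subset_leq_card sub) _.
apply: leq_trans (leq_card_bigcup _ _) _.
by under eq_bigr do rewrite degree; rewrite sum_nat_const mulnC.
Qed.

(** An edge meeting [A] lies within the closure of [A], so no edge joins [O] to [A]. *)
Lemma card_inner_edgesU_closure O A : [disjoint O & edge_closure A] ->
  #|inner_edges (O :|: A)| = (#|inner_edges O| + #|inner_edges A|)%N.
Proof.
move=> OA; apply/eqP; rewrite eqn_leq card_inner_edgesU_ge ?andbT; last first.
  by apply: disjointWr OA; exact: subsetUl.
apply: leq_trans (leq_cardsU _ _); apply/subset_leq_card/subsetP => e.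
rewrite !inE => /andP[eE eOA]; rewrite eE /=.
have [eA|eA] := boolP [disjoint e & A]; apply/orP; [left|right].
  apply/subsetP => x xe; have := subsetP eOA x xe; rewrite inE => /orP[//|xA].
  by rewrite (disjointFr eA xe) in xA.
apply/subsetP => x xe; have := subsetP eOA x xe; rewrite inE => /orP[xO|//].
suff xT : x \in edge_closure A by rewrite (disjointFr OA xO) in xT.
by rewrite inE; apply/orP; right; apply/bigcupP; exists e; rewrite // inE eE.
Qed.

(** * Weights of vertex sets and of events *)

Section Weight.
Variables (R : realType) (a b : R).

Definition energy P : R :=
  2 * a * #|P|%:R - 2 * b * ((deg * #|P|)%:R - (2 * #|inner_edges P|)%:R).

Definition set_weight P : R := expR (energy P).

(** Unnormalized: probabilities are quotients by [event_weight predT]. *)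
Definition event_weight (F : {set V} -> bool) : R := \sum_(P | F P) set_weight P.

Lemma set_weight_ge0 P : 0 <= set_weight P. Proof. exact: expR_ge0. Qed.

Lemma event_weight_le (F G : {set V} -> bool) :
  (forall P, F P -> G P) -> event_weight F <= event_weight G.
Proof.
move=> FG; rewrite /event_weight [leRHS](bigID F) /= (eq_bigl F); last first.
  by move=> P; case: (boolP (F P)) => [/FG ->|]; rewrite ?andbF.
by rewrite lerDl; apply: sumr_ge0 => P _; exact: set_weight_ge0.
Qed.

(** With m positive ends, 1 - 2m + 4[m = 2] takes the values 1, -1, 1 at m = 0, 1, 2. Each term of
    this form can be summed over the edges. *)
Lemma spin_product (e P : {set V}) : #|e| = 2%N ->
  \prod_(x in e) spin R (x \in P) = 1 - 2 * #|e :&: P|%:R + 4 * (e \subset P)%:R.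
Proof.
move/eqP/cards2P => [x [y [xy ->]]].
rewrite big_setU1 ?inE //= big_set1 subUset !sub1set.
have -> : #|[set x; y] :&: P| = ((x \in P) + (y \in P))%N.
  rewrite -sum1_card (eq_bigl (fun z => (z \in [set x; y]) && (z \in P))); last first.
    by move=> z; rewrite !inE.
  rewrite big_mkcondr /= big_setU1 ?inE //= big_set1.
  by case: (x \in P); case: (y \in P).
by rewrite /spin; case: (x \in P); case: (y \in P) => /=; ring.
Qed.

Lemma sum_spin P : \sum_x spin R (x \in P) = 2 * #|P|%:R - #|V|%:R.
Proof.
rewrite (eq_bigr (fun x => 2 * (x \in P)%:R - 1)); last first.
  by move=> x _; rewrite /spin; case: (x \in P) => /=; ring.
rewrite sumrB -mulr_sumr -natr_sum sumr_const cardT -cardE.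
by rewrite -[#|P|]sum1_card [in RHS]big_mkcond.
Qed.

Lemma sum_card_edgeI P : (\sum_(e in E) #|e :&: P| = deg * #|P|)%N.
Proof.
under eq_bigr => e _ do rewrite -sum1_card.
rewrite (exchange_big_dep (mem P)) /=; last by move=> e x _; rewrite inE => /andP[].
rewrite (eq_bigr (fun=> deg)) ?sum_nat_const 1?mulnC // => x xP.
rewrite -(degree x) -sum1_card; apply: eq_bigl => e.
by rewrite !inE xP andbT.
Qed.

Lemma sum_edge_spin P :
  \sum_(e in E) \prod_(x in e) spin R (x \in P)
  = #|E|%:R - 2 * ((deg * #|P|)%:R - (2 * #|inner_edges P|)%:R).
Proof.
rewrite (eq_bigr (fun e => 1 - 2 * #|e :&: P|%:R + 4 * (e \subset P)%:R)); last first.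
  by move=> e /card_edge e2; exact: spin_product.
rewrite big_split sumrB /= -!mulr_sumr -!natr_sum sum_card_edgeI sumr_const.
have -> : (\sum_(e in E) (e \subset P) = #|inner_edges P|)%N.
  rewrite -sum1_card [RHS](eq_bigl (fun e => (e \in E) && (e \subset P))) ?big_mkcondr //.
  by move=> e; rewrite inE.
by rewrite [(2 * _)%:R]natrM; ring.
Qed.

Hypotheses (b_ge0 : 0 <= b) (ab_le0 : a + deg%:R * b <= 0).

(** Adding the vertices of D = Q \ P changes the energy by at most 2a|D| - 2b deg|D| + 4b deg|D| =
    2|D|(a + deg b). *)
Lemma energyU_le P Q : energy (P :|: Q) <= energy P.
Proof.
have -> : P :|: Q = P :|: (Q :\: P) by apply/setP => x; rewrite !inE; case: (x \in P).
set D := Q :\: P; have PD : [disjoint P & D].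
  by rewrite disjoint_sym -setI_eq0 setIDAC setDIl setDv setI0 .
have := card_inner_edgesU_le P D; rewrite -(ler_nat R) natrD natrM => /(ler_wpM2l b_ge0).
have : #|D|%:R * (a + deg%:R * b) <= 0 by rewrite mulr_ge0_le0.
by rewrite /energy cardsU (disjoint_setI0 PD) cards0 subn0 !natrM !natrD; lra.
Qed.

Lemma energyU_ge P Q : [disjoint P & Q] -> energy P + energy Q <= energy (P :|: Q).
Proof.
move=> PQ; have := card_inner_edgesU_ge PQ; rewrite -(ler_nat R) natrD => /(ler_wpM2l b_ge0).
by rewrite /energy cardsU (disjoint_setI0 PQ) cards0 subn0 !natrM !natrD; lra.
Qed.

Lemma energyU_closure O A : [disjoint O & edge_closure A] ->
  energy (O :|: A) = energy O + energy A.
Proof.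
move=> OA; have OA' : [disjoint O & A] by apply: disjointWr OA; exact: subsetUl.
rewrite /energy card_inner_edgesU_closure // cardsU (disjoint_setI0 OA') cards0 subn0.
by rewrite !natrM !natrD; ring.
Qed.

(** [f] changes nothing outside [S], so within a fibre [P] is determined by its trace on [S]. *)
Lemma card_fibre_le (S : {set V}) (F : {set V} -> bool) (f : {set V} -> {set V}) :
  (forall P, P :\: S = f P :\: S) ->
  forall Q, (#|[set P in F | f P == Q]| <= 2 ^ #|S|)%N.
Proof.
move=> fS Q; rewrite -card_powerset.
have inj : {in [set P in F | f P == Q] &, injective (fun P => P :&: S)}.
  move=> P P'; rewrite !inE => /andP[_ /eqP fP] /andP[_ /eqP fP'] /= PP'.
  by rewrite -(setID P S) -(setID P' S) PP' [P :\: S]fS [P' :\: S]fS fP fP'.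
rewrite -(card_in_imset inj); apply/subset_leq_card/subsetP => _ /imsetP[P _ ->].
by rewrite powersetE subsetIr.
Qed.

(** The deletion map [f] removes the closure [T]. Since [P] contains [f P :|: A], whose energy is
    the sum of the two energies, w(P) is at most w(A) w(f P); a fibre of [f] has at most 2^|T|
    elements. *)
Lemma event_weight_contains_le A :
  event_weight (fun P => A \subset P)
  <= 2 ^+ #|edge_closure A| * set_weight A * event_weight predT.
Proof.
set T := edge_closure A; pose f (P : {set V}) := P :\: T.
rewrite mulrAC mulrC.
have le : event_weight (fun P => A \subset P)
    <= set_weight A * \sum_(P : {set V} | A \subset P) set_weight (f P).
  rewrite mulr_sumr; apply: ler_sum => P AP; rewrite /set_weight -expRD ler_expR.
  have fT : [disjoint f P & T] by rewrite disjoints_subset /f setDE subsetIr.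
  rewrite addrC -energyU_closure //.
  have -> : P = (f P :|: A) :|: P.
    by apply/esym/setUidPr; rewrite subUset subsetDl.
  have -> : f (f P :|: A :|: P) = f P.
    by congr (_ :\: _); apply/setUidPr; rewrite subUset subsetDl.
  exact: energyU_le.
apply: le_trans le _; rewrite ler_wpM2l ?set_weight_ge0 // -natrX.
apply: sum_fibre_le => // [P|Q]; first exact: set_weight_ge0.
by apply: card_fibre_le => P; rewrite /f setDDl setUid.
Qed.

(** Read as a conditional bound: given an event [F] that ignores [S], the trace on [S] is [A] with
    probability at least w(A) / 2^|S|. The map [f] resets the trace to [A]: emptying [S] cannot
    lower the weight, and inserting [A] multiplies it by at least w(A). *)
Lemma event_weight_insert_le (F : {set V} -> bool) A S : A \subset S ->
  (forall P Q, P :\: S = Q :\: S -> F P = F Q) ->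
  set_weight A * event_weight F
  <= 2 ^+ #|S| * event_weight (fun P => F P && (P :&: S == A)).
Proof.
move=> AS FS; pose f (P : {set V}) := (P :\: S) :|: A.
have fS P : P :\: S = f P :\: S.
  have AS0 : A :\: S = set0 by apply/eqP; rewrite setD_eq0.
  by rewrite /f setDUl setDDl setUid AS0 setU0.
have le : set_weight A * event_weight F <= \sum_(P | F P) set_weight (f P).
  rewrite mulr_sumr; apply: ler_sum => P FP; rewrite /set_weight -expRD ler_expR addrC.
  have PS : [disjoint P :\: S & A].
    by apply: disjointWr AS _; rewrite -setI_eq0 setIDAC setDIl setDv setI0.
  apply: le_trans (energyU_ge PS); rewrite lerD2r -{1}(setID P S) setUC.
  exact: energyU_le.
apply: le_trans le _; rewrite -natrX.
apply: (@sum_fibre_le R _ _ F (fun P => F P && (P :&: S == A))).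
- exact: set_weight_ge0.
- move=> P FP; apply/andP; split; first by rewrite -(FS _ _ (fS P)).
  by rewrite /f setIUl setIDAC setDIl setDv setI0 set0U (setIidPl AS).
- exact: card_fibre_le.
Qed.

(** Induction on [s]: avoiding one more pattern costs a factor at most 1 - w / 2^k <= exp(- w /
    2^k). *)
Lemma event_weight_avoid_le (I : eqType) (s : seq I) (A S : I -> {set V})
    (k : nat) (w : R) : uniq s ->
  {in s, forall i, [/\ A i \subset S i, (#|S i| <= k)%N & set_weight (A i) = w]} ->
  {in s &, forall i j, i != j -> [disjoint S i & S j]} ->
  event_weight (fun P => all (fun i => P :&: S i != A i) s)
  <= expR (- (w / 2 ^+ k) * (size s)%:R) * event_weight predT.
Proof.
elim: s => [|i s IH] /=.
  by rewrite mulr0 expR0 mul1r => *; exact: event_weight_le.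
case/andP => is_ us H D.
have {}IH := IH us (sub_in1 (mem_behead (s := i :: s)) H) (sub_in2 (mem_behead (s := i :: s)) D).
set F := fun P => all _ s in IH.
have [Ai Si wi] := H i (mem_head _ _).
(* By disjointness, the constraints on the other sets do not see the trace on [S i]. *)
have FS P Q : P :\: S i = Q :\: S i -> F P = F Q.
  move=> PQ; apply: eq_in_all => j js; congr (_ != _).
  have ij : [disjoint S j & S i].
    by apply: D; rewrite ?inE ?eqxx ?js ?orbT //; apply: contraNneq is_ => <-.
  have SD : S j = S j :\: S i by apply/esym/setDidPl.
  by rewrite SD !setIDA -!setIDAC PQ.
have le := event_weight_insert_le Ai FS.
have split_F : event_weight F = event_weight (fun P => F P && (P :&: S i == A i))
    + event_weight (fun P => (P :&: S i != A i) && F P).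
  rewrite [LHS](bigID (fun P => P :&: S i == A i)) /=; congr (_ + _).
  by apply: eq_bigl => P; rewrite andbC.
have F0 : 0 <= event_weight F by apply: sumr_ge0 => *; exact: set_weight_ge0.
have le2 : w / 2 ^+ k * event_weight F <= event_weight (fun P => F P && (P :&: S i == A i)).
  rewrite mulrAC ler_pdivrMr ?exprn_gt0 // -wi; apply: le_trans le _.
  rewrite mulrC ler_wpM2l ?sumr_ge0 // => [*|]; first exact: set_weight_ge0.
  by rewrite ler_weXn2l // ler1n.
have -> : - (w / 2 ^+ k) * (size s).+1%:R = - (w / 2 ^+ k) + - (w / 2 ^+ k) * (size s)%:R.
  by rewrite -natr1; ring.
rewrite expRD -mulrA; apply: le_trans (ler_wpM2l (expR_ge0 _) IH).
apply: le_trans (ler_wpM2r F0 (expR_ge1Dx _)).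
by rewrite mulrDl mul1r mulNr -subr_ge0; move: le2; rewrite split_F; lra.
Qed.

End Weight.
End RegularGraph.

(** Greedy selection: pick [y] in [Y], drop the at most [K] indices whose sets meet [S y], and
    recurse. As [S y] is nonempty, [y] itself is dropped and the cardinality decreases. *)
Lemma disjoint_packing (I V : finType) (S : I -> {set V}) (K : nat) (Y : {set I}) :
  (forall i, S i != set0) ->
  (forall i, (#|[set j | ~~ [disjoint S i & S j]]| <= K)%N) ->
  exists s : seq I, [/\ uniq s, {subset s <= Y},
    {in s &, forall i j, i != j -> [disjoint S i & S j]} & (#|Y| <= K * size s)%N].
Proof.
move=> S0 SK; have [m] := ubnP #|Y|; elim: m => // m IH in Y *; rewrite ltnS => Ym.
have [->|[y yY]] := set_0Vmem Y; first by exists [::]; split; rewrite ?cards0.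
set C := [set j | ~~ [disjoint S y & S j]].
have yC : y \in C by rewrite inE -setI_eq0 setIid S0.
have [|s [us sY sD sK]] := IH (Y :\: C).
  apply: leq_trans Ym; apply: proper_card; rewrite properE subsetDl /=.
  by apply/subsetPn; exists y; rewrite // inE yC.
have ys j : j \in s -> [disjoint S y & S j].
  by move/sY; rewrite !inE negbK => /andP[].
exists (y :: s); split => /=.
- by rewrite us andbT; apply: contraL yC => /ys; rewrite inE negbK.
- by move=> j; rewrite inE => /orP[/eqP->//|/sY]; rewrite inE => /andP[].
- move=> i j; rewrite !inE => /orP[/eqP->|si] /orP[/eqP->|sj] ij; last exact: sD.
  + by rewrite eqxx in ij.
  + exact: ys.
  + by rewrite disjoint_sym; exact: ys.
- rewrite -(cardsID C Y) mulnS leq_add //; apply: leq_trans (SK y).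
  exact/subset_leq_card/subsetIr.
Qed.

(** * The torus as a regular graph, and its Gibbs measure *)

Section Torus.
Variables d n : nat.
Hypothesis n_gt1 : (1 < n)%N.
Implicit Types (x y : torus d n) (A : {set torus d n}).

Lemma neighbor_sym : symmetric (@neighbor d n).
Proof. by move=> x y; rewrite /neighbor /= -(opprB x y) supnormN. Qed.

Lemma neighbor_irr x : neighbor x x = false.
Proof. by rewrite /neighbor /= subrr supnorm0. Qed.

Lemma card_edges_elt : {in edges d n, forall e : {set torus d n}, #|e| = 2%N}.
Proof.
move=> e /imsetP[[x y] /=]; rewrite inE /= => xy ->; rewrite cards2.
by case: eqVneq xy => // ->; rewrite neighbor_irr.
Qed.

Lemma mem_edges x y : neighbor x y -> [set x; y] \in edges d n.
Proof. by move=> xy; apply/imsetP; exists (x, y); rewrite ?inE. Qed.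

Lemma degree_torus x : #|[set e in edges d n | x \in e]| = valence d n.
Proof.
rewrite -(card_neighbor x) -(@card_in_imset _ _ (fun y => [set x; y])); last first.
  move=> y z; rewrite !inE => xy xz /= e.
  have : y \in [set x; z] by rewrite -e !inE eqxx orbT.
  by rewrite !inE => /orP[] /eqP // yx; rewrite yx neighbor_irr in xy.
apply: eq_card => e; rewrite inE; apply/andP/imsetP => [[]|[y]].
  case/imsetP => [[y z] /=]; rewrite inE /= => yz ->.
  rewrite !inE => /orP[] /eqP ->; first by exists z; rewrite ?inE.
  by exists y; rewrite ?inE 1?neighbor_sym // setUC.
by rewrite inE => xy ->; rewrite mem_edges // !inE eqxx.
Qed.

Definition translate x A : {set torus d n} := [set x + y | y in A].

Lemma card_translate x A : #|translate x A| = #|A|.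
Proof. by apply: card_imset; exact: addrI. Qed.

Lemma translateK x A : translate (- x) (translate x A) = A.
Proof.
by rewrite /translate -imset_comp (eq_imset (g := id)) ?imset_id // => y /=; rewrite addKr.
Qed.

Lemma card_inner_edges_translate x A :
  #|inner_edges (edges d n) (translate x A)| = #|inner_edges (edges d n) A|.
Proof.
(* One inequality for all translations suffices: translating back by [- x] gives the other. *)
suff le y B : (#|inner_edges (edges d n) B| <= #|inner_edges (edges d n) (translate y B)|)%N.
  by apply/eqP; rewrite eqn_leq le andbT -{2}[A](translateK x) le.
rewrite -(card_imset _ (imset_inj (@addrI _ y))).
apply/subset_leq_card/subsetP => _ /imsetP[e + ->]; rewrite !inE => /andP[+ eB].
rewrite imsetS ?andbT // => /imsetP[[z t]] /=; rewrite inE /= => zt ->.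
by rewrite imsetU1 imset_set1 mem_edges // /neighbor /= opprD addrACA subrr add0r.
Qed.

Lemma set_weight_translate (R : realType) (a b : R) x A :
  set_weight (edges d n) (valence d n) a b (translate x A)
  = set_weight (edges d n) (valence d n) a b A.
Proof. by rewrite /set_weight /energy card_inner_edges_translate card_translate. Qed.

Definition config_of A : config d n := [ffun x => x \in A].

(** By [sum_spin] and [sum_edge_spin], the Gibbs factor is [set_weight] times a constant [c]
    independent of the configuration, which cancels in the quotient. *)
Lemma gibbs_measure_event (R : realType) (a b : R) (G : config d n -> bool) :
  gibbs_measure a b [set s | G s]
  = event_weight (edges d n) (valence d n) a b (fun A => G (config_of A))
    / event_weight (edges d n) (valence d n) a b predT.
Proof.
have bij : bijective config_of.
  exists (fun s : config d n => [set x | s x]) => [A|s].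
    by apply/setP => x; rewrite inE ffunE.
  by apply/ffunP => x; rewrite ffunE inE.
pose c := expR (b * #|edges d n|%:R - a * #|{: torus d n}|%:R).
have gE A : gibbs_factor a b (config_of A)
    = c * set_weight (edges d n) (valence d n) a b A.
  rewrite /gibbs_factor -expRD; congr expR.
  under eq_bigr do rewrite ffunE.
  under [X in b * X]eq_bigr do under eq_bigr do rewrite ffunE.
  rewrite sum_spin (sum_edge_spin card_edges_elt degree_torus) /energy; ring.
have c0 : c != 0 by rewrite gt_eqF ?expR_gt0.
rewrite /gibbs_measure /gibbs -mulr_suml /partition_function.
rewrite (reindex config_of) /=; last exact: onW_bij.
rewrite (reindex config_of) /=; last exact: onW_bij.
under eq_bigr do rewrite gE.
under [X in _ / X]eq_bigr do rewrite gE.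
rewrite -!mulr_sumr -mulf_div mulfV // mul1r /event_weight; congr (_ / _).
by apply: eq_bigl => A; rewrite inE.
Qed.

End Torus.

(** * Occurrences of a local configuration in translated windows *)

Section LocalConfig.
Variables (d n r : nat) (eta : local_config d r).
Hypotheses (n_gt1 : (1 < n)%N) (n_gt2r : (2 * r < n)%N).

(** Equal to B(0,r) by [offset_ball]; the image form gives each point an index in the box. *)
Definition window : {set torus d n} := [set offset n u | u : box d r].

Lemma Vplus_window : Vplus n eta \subset window.
Proof. by apply/subsetP => _ /imsetP[u _ ->]; apply/imsetP; exists u. Qed.

Lemma card_window : #|window| = #|box d r|.
Proof. by rewrite card_imset //; exact: offset_inj. Qed.

(** This recasts an occurrence as a prescribed trace on a window, the form used in
    [event_weight_avoid_le]. *)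
Lemma occurs_config_of (x : torus d n) A :
  occurs eta x (config_of A) = (A :&: translate x window == translate x (Vplus n eta)).
Proof.
have memV u : (x + offset n u \in translate x (Vplus n eta)) = eta u.
  rewrite mem_imset; last exact: addrI.
  by rewrite mem_imset ?inE //; exact: offset_inj.
have memW (u : box d r) : x + offset n u \in translate x window by rewrite !imset_f.
apply/forallP/eqP => [h|h u].
  apply/setP => y; rewrite inE.
  have [/imsetP[_ /imsetP[u _ ->] ->]|yW] := boolP (y \in translate x window).
    by rewrite memV -(eqP (h u)) ffunE andbT.
  rewrite andbF; apply/esym/negP => yV; case/negP: yW.
  by apply: subsetP yV; apply: imsetS; exact: Vplus_window.
by rewrite ffunE -memV -h inE memW andbT.
Qed.

Lemma weight_set_weight (R : realType) (a b : R) :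
  weight n eta a b = set_weight (edges d n) (valence d n) a b (Vplus n eta).
Proof.
by rewrite /weight /set_weight /energy /perimeter /kplus mulrzBr -!pmulrn.
Qed.

(** A common point x + offset u = y + offset v determines [y] from the pair (u, v). *)
Lemma card_window_conflict (x : torus d n) :
  (#|[set y | ~~ [disjoint translate x window & translate y window]]| <= #|box d r| ^ 2)%N.
Proof.
pose f (p : box d r * box d r) : torus d n := x + offset n p.1 - offset n p.2.
have -> : (#|box d r| ^ 2 = #|{: box d r * box d r}|)%N by rewrite card_prod mulnn.
apply: leq_trans (leq_imset_card f _); apply/subset_leq_card/subsetP => y; rewrite inE.
case/pred0Pn => _ /andP[/imsetP[_ /imsetP[u _ ->] ->] /imsetP[_ /imsetP[v _ ->] e]].
by apply/imsetP; exists (u, v); rewrite // /f /= e addrK.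
Qed.

End LocalConfig.

(** Neighbors of 0 lie in the ball of radius 1. The bound is uniform in [n], which keeps the
    constant of the upper bound fixed as n grows. *)
Lemma valence_le d n : (2 < n)%N -> (valence d n <= #|box d 1|)%N.
Proof.
move=> n2; have n1 : (1 < n)%N by lia.
rewrite -(card_imset _ (@offset_inj d n 1 n1 n2)); apply/subset_leq_card/subsetP => y.
by rewrite offset_ball // !inE distE // /neighbor /= => /eqP ->.
Qed.

(** * Blocks: cardinalities and covering *)

Section Blocks.
Variables (d n k : nat).
Hypotheses (n_gt1 : (1 < n)%N) (k_n : (2 * k + 1 %| n)%N).

Lemma card_ball_ge (x : torus d n) : (k ^ d <= #|ball x k|)%N.
Proof.
have n2k : (2 * k < n)%N by have := dvdn_leq (ltnW n_gt1) k_n; lia.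
have -> : ball x k = translate x (ball 0 k).
  apply/setP => y; rewrite -[y in RHS](subrKC x) mem_imset; last exact: addrI.
  by rewrite !inE !distE // subr0.
rewrite card_translate -offset_ball // card_imset; last exact: offset_inj.
rewrite card_ffun !card_ord; case: (posnP d) => [->|d0]; rewrite ?expn0 //.
by rewrite leq_exp2r //; lia.
Qed.

Lemma card_centers_le : (#|centers d n k| <= (n %/ (2 * k + 1)) ^ d)%N.
Proof.
pose f (g : {ffun 'I_d -> 'I_(n %/ (2 * k + 1))}) : torus d n :=
  \row_i (g i * (2 * k + 1))%N%:R.
have -> : ((n %/ (2 * k + 1)) ^ d = #|{ffun 'I_d -> 'I_(n %/ (2 * k + 1))}|)%N.
  by rewrite card_ffun !card_ord.
apply: leq_trans (leq_imset_card f _); apply/subset_leq_card/subsetP => x; rewrite inE.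
move=> /forallP /(_ _)/existsP h.
apply/imsetP; exists [ffun i => xchoose (h i)] => //.
by apply/rowP => i; rewrite mxE ffunE; exact/eqP/(xchooseP (h i)).
Qed.

(** Each coordinate is divided by p = 2k + 1: if the remainder is at most [k] it is rounded down to
    a multiple of p, otherwise up. *)
Lemma ball_centers_cover (y : torus d n) : exists2 x, x \in centers d n k & y \in ball x k.
Proof.
move: k_n; set p := (2 * k + 1)%N => pn; set m := (n %/ p)%N.
have nE : n = (m * p)%N by rewrite /m divnK.
have p0 : (0 < p)%N by rewrite /p addn1.
have m0 : (0 < m)%N by rewrite lt0n; apply: contraTneq n_gt1 => m0; rewrite nE m0.
have [q hq] : exists q : 'I_d -> 'I_m, forall i, (cycle_abs (y ord0 i - (q i * p)%N%:R)%R <= k)%N.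
  suff h i : exists q : 'I_m, (cycle_abs (y ord0 i - (q * p)%N%:R)%R <= k)%N.
    by exists (fun i => xchoose (h i)) => i; exact: (xchooseP (h i)).
  have := Zn_lt n_gt1 (y ord0 i); set z := y ord0 i => zn.
  have zE := divn_eq z p; set t := (z %% p)%N in zE; set j := (z %/ p)%N in zE.
  have tp : (t < p)%N by rewrite ltn_mod /p addn1.
  have jm : (j < m)%N by rewrite ltn_divLR // -nE.
  have [tk|tk] := leqP t k.
    exists (Ordinal jm) => /=; rewrite /cycle_abs Zn_subrE // Zn_natE //; last lia.
    by rewrite zE leq_addr addKn geq_min tk.
  have [jm1|jm1] := ltnP j.+1 m.
    exists (Ordinal jm1) => /=; rewrite /cycle_abs Zn_subrE // Zn_natE //; last first.
      by rewrite nE ltn_mul2r jm1 /p addn1.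
    rewrite ifF; last by apply/negbTE; rewrite -ltnNge mulSn; lia.
    rewrite geq_min; apply/orP; right; rewrite mulSn; lia.
  (* In the last block, rounding up gives m * p = n, which is 0 on the cycle. *)
  exists (Ordinal m0) => /=; rewrite mul0n subr0 /cycle_abs -/z.
  have jE : m = j.+1 by lia.
  rewrite geq_min; apply/orP; right; 
  have nE' : n = (p + j * p)%N by rewrite [LHS]nE jE mulSn.
  by move: nE' zE tk; rewrite /p; lia.
exists (\row_i (q i * p)%N%:R).
  by rewrite inE; apply/forallP => i; apply/existsP; exists (q i); rewrite mxE.
by rewrite inE distE //; apply/supnorm_leP => i; rewrite !mxE.
Qed.

End Blocks.

(** Union bound for the complement of [F], arranged to yield lower bounds on the probability of
    [F]. *)
Lemma event_weight_union_bound (V I : finType) (E : {set {set V}}) (deg : nat)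
    (R : realType) (a b : R) (F : {set V} -> bool) (D : {pred I})
    (G : I -> {set V} -> bool) :
  (forall P, F P \/ exists2 i, i \in D & G i P) ->
  event_weight E deg a b predT
  <= event_weight E deg a b F + \sum_(i in D) event_weight E deg a b (G i).
Proof.
move=> FG; rewrite {1}/event_weight (bigID F) /= lerD2l.
rewrite /event_weight (exchange_big_dep predT) //= big_mkcond /=.
apply: ler_sum => P _.
have S0 : 0 <= \sum_(i in D | G i P) set_weight E deg a b P.
  by apply: sumr_ge0 => *; exact: set_weight_ge0.
case: ifP => // FP; case: (FG P) => [FP'|[i iD GiP]]; first by rewrite FP' in FP.
rewrite (bigD1 i) /= ?iD // lerDl; apply: sumr_ge0 => *; exact: set_weight_ge0.
Qed.

(** * Bounds on the block measure for fixed n *)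

Section Bounds.
Variables (R : realType) (d n r k : nat) (eta : local_config d r) (a b : R).
Hypotheses (n_gt1 : (1 < n)%N) (n_gt2r : (2 * r < n)%N) (k_n : (2 * k + 1 %| n)%N).
Hypotheses (b_ge0 : 0 <= b) (ab_le0 : a + (valence d n)%:R * b <= 0).

Let ev := event_weight (edges d n) (valence d n) a b.
Let occ x A := occurs eta x (config_of A : config d n).
Let W := weight n eta a b.
Let K := #|box d r|.

Lemma event_weight_gt0 : 0 < ev predT.
Proof.
rewrite /ev /event_weight (bigD1 set0) //= ltr_wpDr ?expR_gt0 //.
by apply: sumr_ge0 => *; exact: set_weight_ge0.
Qed.

Let set_weight_translate_Vplus x :
  set_weight (edges d n) (valence d n) a b (translate x (Vplus n eta)) = W.
Proof. by rewrite set_weight_translate -weight_set_weight. Qed.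

(** The deletion bound for the translate of V_+(eta): it has at most [K] vertices, which bounds the
    size of its closure. *)
Lemma event_weight_occurs_le x :
  ev (occ x) <= 2 ^+ (K + 2 * (valence d n * K)) * W * ev predT.
Proof.
apply: le_trans (_ : _ <= ev (fun P => translate x (Vplus n eta) \subset P)) _.
  apply: event_weight_le => P; rewrite /occ occurs_config_of // => /eqP <-.
  exact: subsetIl.
apply: le_trans (event_weight_contains_le (@card_edges_elt d n) (degree_torus n_gt1)
  b_ge0 ab_le0 _) _.
rewrite set_weight_translate_Vplus ler_wpM2r ?(ltW event_weight_gt0) //.
rewrite ler_wpM2r ?expR_ge0 // ler_weXn2l ?ler1n //.
have kK : (#|translate x (Vplus n eta)| <= K)%N.
  by rewrite card_translate /K -(@card_window d n r n_gt1 n_gt2r) subset_leq_card ?Vplus_window.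
apply: leq_trans (card_edge_closure_le (@card_edges_elt d n) (degree_torus n_gt1) _) _.
by rewrite leq_add // !leq_mul2l kK !orbT.
Qed.

(** A window meets at most [K ^ 2] windows, so at least |Y| / K^2 disjoint ones can be centered in
    [Y]; each contributes W / 2^K to the exponent. *)
Lemma event_weight_no_occurs_le (Y : {set torus d n}) :
  ev (fun P => [forall y in Y, ~~ occ y P])
  <= expR (- (W / (2 ^+ K * (K ^ 2)%:R)) * #|Y|%:R) * ev predT.
Proof.
pose S x : {set torus d n} := translate x (window d n r).
have K0 : (0 < K)%N by rewrite /K card_ffun !card_ord expn_gt0.
have [x|x|s [us sY sD sK]] := @disjoint_packing _ _ S (K ^ 2) Y.
- by rewrite -card_gt0 card_translate card_window.
- exact: card_window_conflict.
apply: le_trans (_ : _ <= ev (fun P => all (fun i => P :&: S i != translate i (Vplus n eta)) s)) _.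
  apply: event_weight_le => P /forall_inP h; apply/allP => y /sY /h.
  by rewrite /occ occurs_config_of.
apply: le_trans (event_weight_avoid_le (@card_edges_elt d n) (degree_torus n_gt1)
  b_ge0 ab_le0 (k := K) (w := W) us _ sD) _.
  move=> x _; split; first by apply: imsetS; exact: Vplus_window.
    by rewrite card_translate card_window.
  exact: set_weight_translate_Vplus.
rewrite ler_wpM2r ?(ltW event_weight_gt0) // ler_expR !mulNr lerN2.
rewrite invfM mulrA -[leLHS]mulrA ler_wpM2l ?divr_ge0 ?exprn_ge0 ?expR_ge0 //.
by rewrite ler_pdivrMl ?ltr0n ?expn_gt0 ?K0 // -natrM ler_nat.
Qed.

Lemma block_measure_event (z : block_config d n k) :
  block_measure a b eta z
  = ev (fun A => renorm k eta (config_of A) == z) / ev predT.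
Proof.
exact: (gibbs_measure_event n_gt1 a b (fun s => renorm k eta s == z)).
Qed.

Lemma block_measure_ge0 (z : block_config d n k) : 0 <= block_measure a b eta z.
Proof.
rewrite block_measure_event divr_ge0 ?(ltW event_weight_gt0) //.
by apply: sumr_ge0 => *; exact: set_weight_ge0.
Qed.

Lemma block_measure_le1 (z : block_config d n k) : block_measure a b eta z <= 1.
Proof.
by rewrite block_measure_event ler_pdivrMr ?event_weight_gt0 // mul1r event_weight_le.
Qed.

(** The balls around the centers cover the torus, so having no occurrence in any block means having
    none at all. *)
Lemma renorm_all_minusP (s : config d n) :
  reflect (forall y, ~~ occurs eta y s) (renorm k eta s == all_minus d n k).
Proof.
apply: (iffP eqP) => [/ffunP h y|h].
  have [x xc yx] := ball_centers_cover n_gt1 k_n y.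
  have := h (exist _ x xc); rewrite !ffunE => /negbT; rewrite negb_exists_in.
  by move/forall_inP => /(_ y yx).
apply/ffunP => x; rewrite !ffunE; apply/negbTE; rewrite negb_exists_in.
exact/forall_inP.
Qed.

Lemma renorm_all_plusP (s : config d n) :
  reflect (forall x, x \in centers d n k -> exists2 y, y \in ball x k & occurs eta y s)
    (renorm k eta s == all_plus d n k).
Proof.
apply: (iffP eqP) => [/ffunP h x xc|h].
  by have := h (exist _ x xc); rewrite !ffunE => /exists_inP.
by apply/ffunP => -[x xc]; rewrite !ffunE; apply/exists_inP; exact: h.
Qed.

Lemma card_torus : #|{: torus d n}| = (n ^ d)%N.
Proof. by rewrite card_mx mul1n card_ord Zp_cast. Qed.

(** Union bound over all n^d vertices. *)
Lemma all_minus_ge :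
  1 - 2 ^+ (K + 2 * (valence d n * K)) * (n%:R ^+ d * W)
  <= block_measure a b eta (all_minus d n k).
Proof.
rewrite block_measure_event ler_pdivlMr ?event_weight_gt0 // mulrBl mul1r lerBlDr.
apply: le_trans (@event_weight_union_bound _ _ _ _ _ _ _
  (fun A => renorm k eta (config_of A) == all_minus d n k) predT occ _) _.
  move=> P; have [|/renorm_all_minusP h] := boolP (renorm k eta (config_of P) == all_minus d n k).
    by left.
  right; apply/exists_inP; apply: contra_notT h; rewrite negb_exists_in.
  by move=> /forall_inP h y; exact: h.
rewrite lerD2l.
apply: le_trans (ler_sum _ (fun x _ => event_weight_occurs_le x)) _.
rewrite sumr_const.
rewrite (card_torus : #|(predT : {pred torus d n})| = _).
rewrite -[leLHS]mulr_natl natrX.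
by rewrite !mulrA [_ ^+ d * _]mulrC.
Qed.

Lemma all_minus_le :
  block_measure a b eta (all_minus d n k)
  <= expR (- (W / (2 ^+ K * (K ^ 2)%:R)) * n%:R ^+ d).
Proof.
rewrite block_measure_event ler_pdivrMr ?event_weight_gt0 // -(natrX _ n) -card_torus -cardsT.
apply: le_trans (event_weight_no_occurs_le _); apply: event_weight_le => P.
by move=> /renorm_all_minusP h; apply/forall_inP => y _; exact: h.
Qed.

(** Union bound over the centers: there are at most (n / k)^d of them, and a negative block has at
    least k^d vertices without an occurrence. *)
Lemma all_plus_ge : (0 < k)%N ->
  1 - (n%:R / k%:R) ^+ d * expR (- (W / (2 ^+ K * (K ^ 2)%:R)) * k%:R ^+ d)
  <= block_measure a b eta (all_plus d n k).
Proof.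
move=> k0.
rewrite block_measure_event ler_pdivlMr ?event_weight_gt0 // mulrBl mul1r lerBlDr.
apply: le_trans (@event_weight_union_bound _ _ _ _ _ _ _
  (fun A => renorm k eta (config_of A) == all_plus d n k) (mem (centers d n k))
  (fun x P => [forall y in ball x k, ~~ occ y P]) _) _.
  move=> P; have [|/renorm_all_plusP h] := boolP (renorm k eta (config_of P) == all_plus d n k).
    by left.
  right; apply/exists_inP; apply: contra_notT h; rewrite negb_exists_in.
  move=> /forall_inP h x /h; rewrite negb_forall_in => /exists_inP[y yx].
  by rewrite negbK => oy; exists y.
rewrite lerD2l.
set e := expR _.
apply: le_trans (ler_sum _ (_ : forall x, x \in centers d n k -> _ <= e * ev predT)) _.
  move=> x _; apply: le_trans (event_weight_no_occurs_le _) _.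
  rewrite ler_wpM2r ?(ltW event_weight_gt0) // ler_expR !mulNr lerN2.
  rewrite ler_wpM2l ?divr_ge0 ?mulr_ge0 ?exprn_ge0 ?expR_ge0 // -(natrX _ k) ler_nat.
  exact: card_ball_ge.
rewrite sumr_const -[leLHS]mulr_natl -mulrA ler_wpM2r //.
  by rewrite mulr_ge0 ?expR_ge0 ?(ltW event_weight_gt0).
apply: le_trans (_ : _ <= (n %/ (2 * k + 1))%:R ^+ d) _.
  by rewrite -natrX ler_nat; exact: card_centers_le.
rewrite lerXn2r ?nnegrE ?divr_ge0 // ler_pdivlMr ?ltr0n // -natrM ler_nat.
by apply: leq_trans (leq_trunc_div n (2 * k + 1)); rewrite leq_mul2l; apply/orP; right; lia.
Qed.

End Bounds.

(** * Passage to the limit *)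

Local Open Scope classical_set_scope.

(** The shift [e] accounts for the factor (n/R)^d in (3); for (2) it is 0. *)
Lemma cvg_expRN_affine (R : realType) (c e : R) (u : nat -> R) : 0 < c ->
  u j @[j --> \oo] --> +oo -> expR (- (c * u j - e)) @[j --> \oo] --> (0 : R).
Proof.
move=> c0 /cvgryPge hu.
apply: (@cvg_comp _ _ _ (fun j => c * u j - e) (fun x => expR (- x)) _ +oo).
  apply/cvgryPge => A; have := hu ((A + e) / c).
  by apply: filterS => j; rewrite ler_pdivrMr // mulrC lerBrDr.
exact: cvgr_expR.
Qed.

Theorem proposition6p2 (R : realType) (d r : nat) (eta : local_config d r)
    (* [N] enumerates the sizes n; [rad n] is the block radius R(n) *)
    (N rad : nat -> nat) (a b : nat -> R) :
  (1 <= d)%N -> (1 <= r)%N ->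
  {homo N : i j / (i <= j)%N} ->
  N @ \oo --> \oo ->
  (forall j, (2 * r < N j)%N) ->
  (forall j, (0 < rad (N j))%N) ->
  {homo (fun j => rad (N j)) : i j / (i <= j)%N} ->
  (forall j, (2 * rad (N j) + 1 %| N j)%N) ->
  {homo (fun j => N j %/ (2 * rad (N j) + 1))%N : i j / (i <= j)%N} ->
  (forall j, a (N j) < 0) ->
  (forall j, 0 <= b (N j)) ->
  (forall j, a (N j) + 2 * (valence d (N j))%:R * b (N j) <= 0) ->
  let W n := weight n eta (a n) (b n) in
  let mu n (z : block_config d n (rad n)) := block_measure (a n) (b n) eta z in
  [/\ ((N j)%:R ^+ d * W (N j) @[j --> \oo] --> 0 ->
       mu (N j) (all_minus d (N j) (rad (N j))) @[j --> \oo] --> (1 : R)),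
      ((N j)%:R ^+ d * W (N j) @[j --> \oo] --> +oo ->
       mu (N j) (all_minus d (N j) (rad (N j))) @[j --> \oo] --> (0 : R))
    & ((rad (N j))%:R ^+ d
         * (ln ((N j)%:R / (rad (N j))%:R))^-1
         * W (N j) @[j --> \oo] --> +oo ->
       mu (N j) (all_plus d (N j) (rad (N j))) @[j --> \oo] --> (1 : R))].
Proof.
move=> d1 r1 _ _ N2r rad0 _ radN _ a0 b0 ab0 W mu.
have N1 j : (1 < N j)%N by have := N2r j; lia.
have N2 j : (2 < N j)%N by have := N2r j; lia.
(* Half the sum of a < 0 and a + 2Vb <= 0. *)
have ab j : a (N j) + (valence d (N j))%:R * b (N j) <= 0.
  by have := ab0 j; have := a0 j; rewrite -mulrA; lra.
pose K := #|box d r|; pose c : R := (2 ^+ K * (K ^ 2)%:R)^-1.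
have c0 : 0 < c.
  by rewrite invr_gt0 mulr_gt0 ?exprn_gt0 // ltr0n expn_gt0 /K card_ffun !card_ord expn_gt0.
have mu0 j z : 0 <= mu (N j) z by exact: block_measure_ge0.
have mu1 j z : mu (N j) z <= 1 by exact: block_measure_le1.
have W0 j : 0 <= W (N j) by exact: expR_ge0.
split=> hW.
(* The degree is replaced by its bound [#|box d 1|], so that [C] does not depend on [j]. *)
- pose C : R := 2 ^+ (K + 2 * (#|box d 1| * K)).
  apply: (@squeeze_cvgr _ _ _ _ (fun j => 1 - C * ((N j)%:R ^+ d * W (N j))) (cst 1)).
  + apply: nearW => j; rewrite /cst mu1 andbT.
    apply: le_trans (all_minus_ge eta (N1 j) (N2r j) (radN j) (b0 j) (ab j)).
    rewrite lerD2l lerN2 ler_wpM2r ?mulr_ge0 ?exprn_ge0 ?W0 //.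
    by rewrite ler_weXn2l ?ler1n // leq_add2l leq_mul2l leq_mul2r valence_le ?orbT.
  + rewrite -[X in _ --> X]subr0 -[X in _ - X](mulr0 C).
    by apply: cvgB; [exact: cvg_cst | apply: cvgMr; exact: hW].
  + exact: cvg_cst.
- apply: (@squeeze_cvgr _ _ _ _ (cst 0) 
    (fun j => expR (- (c * ((N j)%:R ^+ d * W (N j)) - 0)))).
  + apply: nearW => j; rewrite /cst mu0 /=.
    apply: le_trans (all_minus_le eta (N1 j) (N2r j) (radN j) (b0 j) (ab j)) _.
    by rewrite subr0 ler_expR mulNr lerN2 -/(W (N j)) -/c mulrAC mulrC [W _ * _]mulrC.
  + exact: cvg_cst.
  + exact: cvg_expRN_affine.
pose L j : R := ln ((N j)%:R / (rad (N j))%:R).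
pose t j : R := (rad (N j))%:R ^+ d * (L j)^-1 * W (N j).
have radgt0 j : 0 < (rad (N j))%:R :> R by rewrite ltr0n.
(* Divisibility gives 2R + 1 <= n, so n/R >= 2 and [L j] is bounded below by ln 2 > 0. *)
have q2 j : 2 <= (N j)%:R / (rad (N j))%:R :> R.
  rewrite ler_pdivlMr // -natrM ler_nat.
  by have := dvdn_leq (ltnW (N1 j)) (radN j); lia.
have L2 j : ln 2 <= L j by rewrite ler_ln ?posrE // (lt_le_trans _ (q2 j)).
have l2 : 0 < ln 2 :> R by apply: ln_gt0; rewrite ltr1n.
have Lgt0 j : 0 < L j := lt_le_trans l2 (L2 j).
(* The error term of [all_plus_ge] is exp(dL - cWR^d) = exp(- L(ct - d)), because tL = R^d W. *)
apply: (@squeeze_cvgr _ _ _ _ (fun j => 1 - expR (- (ln 2 * c * t j - ln 2 * d%:R))) (cst 1)).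
(* Once ct >= d, the factor [L j] may be replaced by its lower bound ln 2, leaving an exponent
   affine in [t]. *)
- have : \forall j \near \oo, d%:R / c <= t j by move/cvgryPge: hW; apply.
  apply: filterS => j; rewrite ler_pdivrMr // mulrC => tj.
  rewrite /cst mu1 andbT.
  apply: le_trans (all_plus_ge eta (N1 j) (N2r j) (radN j) (b0 j) (ab j) (rad0 j)).
  rewrite lerD2l lerN2 -/(W _) -/K -/c.
  have -> : (N j)%:R / (rad (N j))%:R = expR (L j) :> R.
    by rewrite lnK // posrE (lt_le_trans _ (q2 j)).
  rewrite -expRM_natl -expRD ler_expR.
  have -> : d%:R * L j + - (W (N j) * c) * (rad (N j))%:R ^+ d
      = - (L j * (c * t j - d%:R)).
    by rewrite /t; field; rewrite gt_eqF.
  by rewrite lerN2 -mulrA -mulrBr ler_wpM2r // subr_ge0.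
- rewrite -[X in _ --> X]subr0; apply: cvgB; first exact: cvg_cst.
  by apply: cvg_expRN_affine => //; rewrite mulr_gt0.
- exact: cvg_cst.
Qed.
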